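(* Let $f:\mathbb{R}^d\to(0,\infty]$ be a density satisfying assumption (A). Then the following hold. (a) $\sup_{x\in\mathbb{R}^d}g_2(x)<\infty$ if and only if $\sup_{x\in\mathbb{R}^d}h_2(x)<\infty$; and $g_2(x)\to\infty$ as $|x|\to\infty$ if and only if $h_2(x)\to\infty$ as $|x|\to\infty$. (b) If there exists a constant $C>0$ such that $h_2(x)\le C$ for all $x\in\mathbb{R}^d$, then, for every $n\ge2$, $h_n(x)\le C^{n-1}$ for all $x\in\mathbb{R}^d$. The same implication holds for the functions $g_n$: if $g_2(x)\le C$ for all $x\in\mathbb{R}^d$, then, for every $n\ge 2$, $g_n(x)\le C^{n-1}$ for all $x\in\mathbb{R}^d$. (c) If $g_2(x)\to\infty$ or $h_2(x)\to\infty$ as $|x|\to\infty$, then, for every $n\ge2$, $g_n(x)\to\infty$ and $h_n(x)\to\infty$ as $|x|\to\infty$. (d) If $g_2(x)\to\infty$ or $h_2(x)\to\infty$ as $|x|\to\infty$, then, for all $n>m\ge1$, $\dfrac{h_m(x)}{h_n(x)}\to0$ as $|x|\to\infty$. (e) If $g_2(x)\to\infty$ or $h_2(x)\to\infty$ as $|x|\to\infty$, then, for every $n\in\mathbb{N}$, $\dfrac{g_n(x)}{h_n(x)}\to1$ as $|x|\to\infty$.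
   Context: Let $d\ge 1$, $\mathbb{N}=\{1,2,\dots\}$; $|x|$ is the Euclidean norm. A density is a nonnegative nonzero function in $L^1(\mathbb{R}^d)$ (Lebesgue measure). ''Decreasing'' is meant in the non-strict sense; a function is radial decreasing if $f(x)=F(|x|)$ with $F$ nonincreasing on $[0,\infty)$. Assumption (A): $f:\mathbb{R}^d\to(0,\infty]$ is a density such that (a) $f$ is a radial decreasing function; (b) there is a constant $C_1\ge1$ such that $f(x)\le C_1f(y)$ for $1\le|x|\le|y|\le|x|+1$; (c) there is a constant $C_2\ge1$ such that $f(x)\le C_2f(2x)$ for $|x|\le1$. Functions $h_n,g_n$: $h_1\equiv g_1\equiv1$ on $\mathbb{R}^d$ and, for $n\in\mathbb{N}$, $$h_{n+1}(x):=\frac{\int_{D(x)}f(x-y)f(y)h_n(y)\,dy}{f(x)},\qquad g_{n+1}(x):=\frac{\int_{E(x)}f(x-y)f(y)g_n(y)\,dy}{f(x)},$$ where $D(x)=\{z\in\mathbb{R}^d:|z|<|x|-1,\ |x-z|<|x|-1\}$ and $E(x)=\{z\in\mathbb{R}^d:|z|<|x|,\ |x-z|<|x|\}$. An integral over the empty set equals $0$ and $a/(+\infty)=0$ for $a\ge0$. *)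

(* Defs.v *)
From HB Require Import structures.
From mathcomp Require Import all_boot all_order all_algebra.
From mathcomp Require Import all_classical all_reals all_analysis.

Set Implicit Arguments.
Unset Strict Implicit.
Unset Printing Implicit Defensive.
Import Order.TTheory GRing.Theory Num.Theory.
Import numFieldNormedType.Exports.

Local Open Scope classical_set_scope.
Local Open Scope ring_scope.

(* R^d is 'rV[R]_d, with the sigma-algebra generated by the coordinates,
   i.e. the Borel sigma-algebra. *)
Definition measure_rV_display : measure_display -> measure_display.
Proof. exact. Qed.

Section measurable_rV.
Context {d} {T : sigmaRingType d}.
Variable n : nat.

Let coors : 'I_n -> 'rV[T]_n -> T := fun i x => x ord0 i.

Let rV_set0 : g_sigma_preimage coors set0.
Proof. exact: sigma_algebra0. Qed.

Let rV_setC A : g_sigma_preimage coors A -> g_sigma_preimage coors (~` A).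
Proof. exact: sigma_algebraC. Qed.

Let rV_bigcup (F : _^nat) : (forall i, g_sigma_preimage coors (F i)) ->
  g_sigma_preimage coors (\bigcup_i (F i)).
Proof. exact: sigma_algebra_bigcup. Qed.

HB.instance Definition _ := @isMeasurable.Build (measure_rV_display d)
  'rV[T]_n (g_sigma_preimage coors) rV_set0 rV_setC rV_bigcup.

End measurable_rV.

Lemma measurable_coord d (T : sigmaRingType d) n (i : 'I_n) :
  measurable_fun [set: 'rV[T]_n] (fun x : 'rV[T]_n => x ord0 i).
Proof.
move=> _ Y mY; rewrite setTI; apply: sub_sigma_algebra => /=.
rewrite -bigcup_seq/=; exists i => /=; first by rewrite mem_index_enum.
by exists Y => //; rewrite setTI.
Qed.

Lemma measurable_fun_rV d1 d2 (T1 : measurableType d1) (T2 : measurableType d2)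
    n (f : T1 -> 'rV[T2]_n) :
  (forall i, measurable_fun [set: T1] (fun x => f x ord0 i)) ->
  measurable_fun [set: T1] f.
Proof.
move=> mf.
suff : g_sigma_preimage (fun i x => f x ord0 i) `<=` @measurable _ T1.
  rewrite (@g_sigma_preimage_comp _ _ _ 'rV[T2]_n (fun i x => x ord0 i) _ f).
  by move=> prefS _ A mA; apply: prefS; exists A.
apply: smallest_sub; first exact: sigma_algebra_measurable.
case: n => [|n] in f mf *; first by rewrite big_ord0.
rewrite -bigcup_mkord_ord; apply: bigcup_sub => i Ii.
by move=> A [B mB <-]; exact: mf.
Qed.

Section lebesgue_rV.
Context {R : realType}.

Definition rV_cons n (p : R * 'rV[R]_n) : 'rV[R]_n.+1 :=
  \row_i (if unlift ord0 i is Some j then p.2 ord0 j else p.1).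

Definition rV_uncons n (x : 'rV[R]_n.+1) : R * 'rV[R]_n :=
  (x ord0 ord0, \row_j x ord0 (lift ord0 j)).

Lemma rV_consK n : cancel (@rV_cons n) (@rV_uncons n).
Proof.
move=> [a v]; rewrite /rV_uncons /rV_cons mxE unlift_none; congr (_, _).
by apply/rowP => j; rewrite !mxE liftK.
Qed.

Lemma measurable_rV_cons n : measurable_fun [set: R * 'rV[R]_n] (@rV_cons n).
Proof.
apply: measurable_fun_rV => i; under eq_fun do rewrite mxE.
case: (unlift ord0 i) => [j|]; last exact: measurable_fst.
exact: (measurableT_comp (@measurable_coord _ R n j)).
Qed.

Lemma measurable_rV_uncons n :
  measurable_fun [set: 'rV[R]_n.+1] (@rV_uncons n).
Proof.
apply: measurable_fun_pair; first exact: measurable_coord.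
apply: measurable_fun_rV => i; under eq_fun do rewrite mxE.
exact: measurable_coord.
Qed.

Section step.
Local Open Scope ereal_scope.
Variables (n : nat) (mu : {sigma_finite_measure set 'rV[R]_n -> \bar R}).

Definition lebesgue_rV_step : set 'rV[R]_n.+1 -> \bar R :=
  pushforward (@lebesgue_measure R \x mu) (@rV_cons n).

Let step0 : lebesgue_rV_step set0 = 0.
Proof. by rewrite /lebesgue_rV_step /pushforward preimage_set0 measure0. Qed.

Let step_ge0 A : 0 <= lebesgue_rV_step A.
Proof. by rewrite /lebesgue_rV_step /pushforward; exact: measure_ge0. Qed.

Let step_sigma_additive : semi_sigma_additive lebesgue_rV_step.
Proof.
move=> F mF tF mUF; rewrite /lebesgue_rV_step /pushforward preimage_bigcup.
apply: measure_semi_sigma_additive.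
- by move=> k; rewrite -[X in measurable X]setTI; exact: measurable_rV_cons.
- apply/trivIsetP => /= i j _ _ ij; rewrite -preimage_setI.
  by move/trivIsetP : tF => /(_ _ _ _ _ ij) ->//; rewrite preimage_set0.
- rewrite -preimage_bigcup -[X in measurable X]setTI.
  exact: measurable_rV_cons.
Qed.

HB.instance Definition _ := isMeasure.Build _ _ _ lebesgue_rV_step
  step0 step_ge0 step_sigma_additive.

Let step_sigma_finite : sigma_finite setT lebesgue_rV_step.
Proof.
have /sigma_finiteP[F [TF ndF Foo]] := sigma_finiteT (@lebesgue_measure R).
have /sigma_finiteP[G [TG ndG Goo]] := sigma_finiteT mu.
exists (fun k => @rV_uncons n @^-1` (F k `*` G k)).
  rewrite -preimage_bigcup (_ : \bigcup_k _ = setT) ?preimage_setT//.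
  rewrite -subTset -setXTT TF TG => -[x y] [/= [i _ Fix] [j _ Gjy]].
  exists (maxn i j) => //; split.
  - by move: x Fix; exact/subsetPset/ndF/leq_maxl.
  - by move: y Gjy; exact/subsetPset/ndG/leq_maxr.
move=> k; have [mF Fk] := Foo k; have [mG Gk] := Goo k; split.
  rewrite -[X in measurable X]setTI; apply: measurable_rV_uncons => //.
  exact: measurableX.
rewrite /lebesgue_rV_step /pushforward -comp_preimage.
rewrite (_ : _ \o _ = id); last by apply/funext; exact: rV_consK.
by rewrite preimage_id product_measure1E// lte_mul_pinfty// ge0_fin_numE.
Qed.

HB.instance Definition _ := Measure_isSigmaFinite.Build _ _ _ lebesgue_rV_step
  step_sigma_finite.

End step.

(* Lebesgue measure on R^n as an iterated product: the point mass on R^0, and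
   on R^(n+1) the image of lebesgue_measure \x lebesgue_rV n under the
   identification of R * R^n with R^(n+1). *)
Fixpoint lebesgue_rV n : {sigma_finite_measure set 'rV[R]_n -> \bar R} :=
  match n with
  | 0 => dirac (0 : 'rV[R]_0)
  | m.+1 => lebesgue_rV_step (lebesgue_rV m)
  end.

Lemma lebesgue_rV_box n (a b : 'rV[R]_n) :
  (forall i, a ord0 i <= b ord0 i) ->
  lebesgue_rV n [set x | forall i, x ord0 i \in `[a ord0 i, b ord0 i]] =
  (\prod_i (b ord0 i - a ord0 i))%:E.
Proof.
elim: n a b => [|n IH] a b ab /=.
  by rewrite big_ord0 diracE mem_set// => -[].
rewrite /lebesgue_rV_step/= /pushforward; set P := (X in _ X = _).
pose a' := \row_j a ord0 (lift ord0 j); pose b' := \row_j b ord0 (lift ord0 j).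
pose B := [set x : 'rV[R]_n | forall i, x ord0 i \in `[a' ord0 i, b' ord0 i]].
have -> : P = `[a ord0 ord0, b ord0 ord0]%classic `*` B.
  apply/seteqP; split => -[x v] /= => [H|[H1 H2] i].
    split; first by have := H ord0; rewrite mxE unlift_none.
    by move=> i; have := H (lift ord0 i); rewrite !mxE liftK.
  rewrite mxE; case: unliftP => [j ->|->]//=.
  by have := H2 j; rewrite !mxE.
have mB : measurable B.
  rewrite (_ : B = \bigcap_(i in [set: 'I_n])
      ((fun x : 'rV_n => x ord0 i) @^-1` `[a' ord0 i, b' ord0 i]%classic)).
    apply: fin_bigcap_measurable => // i _.
    by rewrite -[X in measurable X]setTI; exact: measurable_coord.
  by apply/seteqP; split => x /= H i; have := H i => //; apply.
rewrite product_measure1E// IH; last by move=> i; rewrite !mxE.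
rewrite big_ord_recl EFinM.
congr (_ * _)%E; last by congr EFin; apply: eq_bigr => i _; rewrite !mxE.
rewrite -[LHS]/(lebesgue_measure [set` `[a ord0 ord0, b ord0 ord0]]).
rewrite lebesgue_measure_itv /= lte_fin -EFinD; case: ltP => // H.
have /eqP -> : a ord0 ord0 == b ord0 ord0 by rewrite eq_le H ab.
by rewrite subrr.
Qed.

End lebesgue_rV.

Section assumption.
Context {R : realType} {d : nat}.
Local Notation Rd := 'rV[R]_d.
Local Notation mu := (@lebesgue_rV R d).
Local Open Scope ereal_scope.
Implicit Types (f : Rd -> \bar R) (x y z : Rd).

(* The library norm `|x| on row vectors is the sup norm. *)
Definition enorm x : R := Num.sqrt (\sum_(i < d) x ord0 i ^+ 2)%R.

(* "Nonzero" is meant in L^1, i.e. up to null sets. *)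
Definition density f : Prop :=
  [/\ forall x, 0 <= f x,
      mu.-integrable [set: Rd] f &
      ~ {ae mu, forall x, f x = 0}].

Definition radial_decreasing f : Prop :=
  exists2 F : R -> \bar R,
    (forall s t : R, (0 <= s)%R -> (s <= t)%R -> F t <= F s) &
    (forall x, f x = F (enorm x)).

Record assumptionA f : Prop := AssumptionA {
  A_pos : forall x, 0 < f x ;
  A_density : density f ;
  A_radial : radial_decreasing f ;
  A_shift : exists2 C1 : R, (1 <= C1)%R & forall x y,
    (1 <= enorm x)%R -> (enorm x <= enorm y)%R ->
    (enorm y <= enorm x + 1)%R -> f x <= C1%:E * f y ;
  A_double : exists2 C2 : R, (1 <= C2)%R & forall x,
    (enorm x <= 1)%R -> f x <= C2%:E * f (2 *: x)%R
}.

Definition domD x : set Rd :=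
  [set z | (enorm z < enorm x - 1)%R /\ (enorm (x - z)%R < enorm x - 1)%R].

Definition domE x : set Rd :=
  [set z | (enorm z < enorm x)%R /\ (enorm (x - z)%R < enorm x)%R].

(* iter_conv f S n is the n-th function, n >= 1 (the value at n = 0 is
   irrelevant). On extended reals, a / +oo = 0 for every a >= 0. *)
Fixpoint iter_conv f (S : Rd -> set Rd) (n : nat) : Rd -> \bar R :=
  match n with
  | (_.+1 as m).+1 => fun x =>
      (\int[mu]_(y in S x) (f (x - y)%R * f y * iter_conv f S m y)) / f x
  | _ => fun=> 1
  end.

Definition hfun f : nat -> Rd -> \bar R := iter_conv f domD.
Definition gfun f : nat -> Rd -> \bar R := iter_conv f domE.

(* The filter "|x| -> oo". *)
Definition at_infinity : set_system Rd :=
  filter_from [set: R] (fun r => [set x | (r < enorm x)%R]).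

Global Instance at_infinity_filter : Filter at_infinity.
Proof.
apply: filter_from_filter; first by exists 0%R.
move=> r s _ _; exists (Num.max r s) => // x /=.
by rewrite gt_max => /andP[].
Qed.

End assumption.

Arguments at_infinity : clear implicits.

(* Main.v *)
Require Import Defs.
From HB Require Import structures.
From mathcomp Require Import all_boot all_order all_algebra.
From mathcomp Require Import all_classical all_reals all_analysis.
From mathcomp Require Import measurable_realfun.
From mathcomp Require Import ring lra.

Set Implicit Arguments.
Unset Strict Implicit.
Unset Printing Implicit Defensive.
Import Order.TTheory GRing.Theory Num.Theory.
Import numFieldNormedType.Exports.

Local Open Scope classical_set_scope.
Local Open Scope ring_scope.
Local Open Scope ereal_scope.

(** Dividing by [f x], both recursions have the form
    [u_{n+1}(x) = int_{S x} f(x - y) f(y) u_n(y) dy / f(x)], called [nconv]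
    below. Two elementary bounds drive everything ([nconv_le_shifted],
    [nconv_le_centered]): where [f(x - y) <= c f(x)] the quotient is at most
    [c] times the integral of [f u_n], and where [f(y) u_n(y) <= c f(x)] it is
    at most [c] times the integral of [f].

    By the shift condition, [f] loses at most a constant factor over a bounded shift, so the
    part of the integral over a fixed ball contributes a bounded amount for
    large [x] ([nconv_near]); and the domains [D x] and [E x] differ only by
    points within distance one of the spheres [|y| = |x|] and [|x - y| = |x|],
    where one of the two factors is comparable to [f x]. This gives
    [h_2 <= g_2 <= h_2 + K] ([gfun2_le]), hence (a). The geometric bounds of (b)
    are an immediate induction. If [h_2] diverges then the mass of the integral
    defining [h_{n+1}] sits at points [y] far from the origin, where an
    asymptotic relation already known for [h_n] and [g_n] may be inserted under
    the integral; the ball contributes only a constant, negligible against the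
    diverging [h_{n+1}]. This yields (c) and (d) ([hfun_diverges],
    [hfun_littleo]).

    For (e) one also has to control the two collars [E x \ D x] with the
    unbounded weight [g_n]. Near [|x - y| = |x|] it suffices that [f g_n] is
    integrable ([integral_f_gfun]), by Tonelli. Near [|y| = |x|] the weight is
    of order [h_n(y)], and [h_n(y) <= C1 h_n(x)] when [|y| <= |x| <= |y| + 1]
    ([hfun_slow]), so the collar contributes [O(h_n(x)) = o(h_{n+1}(x))] by (d).
    The comparison of [h_n] at [y] and [x] is a direct comparison of integrals
    when [x] is a multiple of [y]; the general case follows because [h_n] is
    radial. Radiality rests on the invariance of Lebesgue measure under
    hyperplane reflections. As the measure is built as an iterated product,
    translation invariance comes by induction on the dimension, and
    reflections are then handled by a Fubini argument that plays the measure
    against the indicator of the unit ball ([integral_isometry]). *)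

(** * Euclidean norm and hyperplane reflections *)

Section euclidean_norm.
Context {R : realType} {d : nat}.
Local Open Scope ring_scope.
Implicit Types (u v w x y : 'rV[R]_d).

Definition dot u v : R := \sum_i u ord0 i * v ord0 i.

Lemma dotC u v : dot u v = dot v u.
Proof. by apply: eq_bigr => i _; rewrite mulrC. Qed.

Lemma dotDl u v w : dot (u + v) w = dot u w + dot v w.
Proof. by rewrite -big_split; apply: eq_bigr => i _; rewrite mxE mulrDl. Qed.

Lemma dotZl (a : R) u v : dot (a *: u) v = a * dot u v.
Proof. by rewrite /dot big_distrr; apply: eq_bigr => i _; rewrite mxE -mulrA. Qed.

Lemma dotNl u v : dot (- u) v = - dot u v.
Proof. by rewrite -scaleN1r dotZl mulN1r. Qed.

Lemma dotDr u v w : dot u (v + w) = dot u v + dot u w.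
Proof. by rewrite dotC dotDl !(dotC u). Qed.

Lemma dotZr (a : R) u v : dot u (a *: v) = a * dot u v.
Proof. by rewrite dotC dotZl (dotC u). Qed.

Lemma dotNr u v : dot u (- v) = - dot u v.
Proof. by rewrite dotC dotNl (dotC u). Qed.

Definition dotE := (dotDl, dotDr, dotNl, dotNr, dotZl, dotZr).

Lemma dot_ge0 u : 0 <= dot u u.
Proof. by apply: sumr_ge0 => i _; rewrite -expr2 sqr_ge0. Qed.

Lemma dot_eq0 u : (dot u u == 0) = (u == 0).
Proof.
apply/eqP/eqP => [/eqP|->]; last by rewrite -[X in dot X _](scale0r 0) dotZl mul0r.
rewrite psumr_eq0 => [/allP u0|i _]; last by rewrite -expr2 sqr_ge0.
apply/rowP => i; rewrite mxE; apply/eqP.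
by have /= := u0 i (mem_index_enum i); rewrite -expr2 sqrf_eq0.
Qed.

Lemma enormE u : enorm u = Num.sqrt (dot u u).
Proof. by congr Num.sqrt; apply: eq_bigr => i _; rewrite expr2. Qed.

Lemma sqr_enorm u : enorm u ^+ 2 = dot u u.
Proof. by rewrite enormE sqr_sqrtr ?dot_ge0. Qed.

Lemma enorm_ge0 u : 0 <= enorm u.
Proof. by rewrite enormE sqrtr_ge0. Qed.

Lemma enorm_eq0 u : (enorm u == 0) = (u == 0).
Proof. by rewrite -sqrf_eq0 sqr_enorm dot_eq0. Qed.

Lemma dot_le_enorm u v : dot u v <= enorm u * enorm v.
Proof.
have [->|u0] := eqVneq u 0.
  by rewrite -{1}(scale0r 0) dotZl mul0r mulr_ge0 ?enorm_ge0.
have [->|v0] := eqVneq v 0.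
  by rewrite dotC -{1}(scale0r 0) dotZl mul0r mulr_ge0 ?enorm_ge0.
have u_gt0 : 0 < enorm u by rewrite lt_def enorm_eq0 u0 enorm_ge0.
have v_gt0 : 0 < enorm v by rewrite lt_def enorm_eq0 v0 enorm_ge0.
have := dot_ge0 (enorm v *: u - enorm u *: v).
rewrite !dotE (dotC v u) -!sqr_enorm => H.
have : 0 <= (enorm u * enorm v) * (enorm u * enorm v - dot u v) by nra.
by rewrite pmulr_rge0 ?mulr_gt0// subr_ge0.
Qed.

Lemma enormD u v : enorm (u + v) <= enorm u + enorm v.
Proof.
rewrite -(@ler_pXn2r _ 2)// ?nnegrE ?addr_ge0 ?enorm_ge0//.
rewrite sqrrD !sqr_enorm !dotE (dotC v u).
by have := dot_le_enorm u v; lra.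
Qed.

Lemma enormN u : enorm (- u) = enorm u.
Proof. by rewrite !enormE !dotE opprK. Qed.

Lemma enormB u v : enorm (u - v) = enorm (v - u).
Proof. by rewrite -opprB enormN. Qed.

Lemma enormZ a u : enorm (a *: u) = `|a| * enorm u.
Proof.
by rewrite !enormE !dotE mulrA -expr2 sqrtrM ?sqr_ge0// sqrtr_sqr.
Qed.

Lemma enorm0 : enorm (0 : 'rV[R]_d) = 0.
Proof. by apply/eqP; rewrite enorm_eq0. Qed.

Lemma enorm_subl_le u v : enorm u <= enorm (u - v) + enorm v.
Proof. by rewrite -{1}(subrK v u) enormD. Qed.

(** The reflection in the hyperplane orthogonal to [w]; for [w = 0] the
    convention [x / 0 = 0] makes it the identity. *)
Definition householder w u : 'rV[R]_d := u - (2 * dot u w / dot w w) *: w.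

Lemma householderD w : {morph householder w : u v / u + v}.
Proof.
move=> u v; rewrite /householder dotDl mulrDr mulrDl scalerDl opprD.
by rewrite !addrA; congr (_ - _); rewrite addrAC.
Qed.

Lemma householderK w : involutive (householder w).
Proof.
move=> u; rewrite /householder -addrA -opprD -scalerDl !dotE.
have [->|w0] := eqVneq w 0; first by rewrite scaler0 subr0.
rewrite [X in X *: w](_ : _ = 0) ?scale0r ?subr0//.
by field; rewrite dot_eq0.
Qed.

Lemma enorm_householder w u : enorm (householder w u) = enorm u.
Proof.
rewrite !enormE; congr Num.sqrt; rewrite /householder.
have [->|w0] := eqVneq w 0; first by rewrite scaler0 subr0.
rewrite !dotE (dotC w u).
by field; rewrite dot_eq0.
Qed.

Lemma householder_swap u v : enorm u = enorm v -> householder (u - v) u = v.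
Proof.
move=> uv; have [->|neq] := eqVneq u v.
  by rewrite /householder subrr scaler0 subr0.
have dd : dot (u - v) (u - v) = 2 * dot u (u - v).
  rewrite !dotE (dotC v u) -!sqr_enorm uv.
  by ring.
rewrite /householder -dd divff; last by rewrite dot_eq0 subr_eq0.
by rewrite scale1r opprB addrC subrK.
Qed.

End euclidean_norm.

(** * Translation invariance of Lebesgue measure *)

Section measurable_row_vectors.
Context {R : realType} {d : nat}.
Local Notation Rd := 'rV[R]_d.

Lemma measurable_rV_comp dd (T : measurableType dd) (f : T -> Rd) :
  measurable_fun [set: T] f ->
  forall i, measurable_fun [set: T] (fun x => f x ord0 i).
Proof. by move=> mf i; exact: (measurableT_comp (@measurable_coord _ R d i)). Qed.

Lemma measurable_rVD dd (T : measurableType dd) (f g : T -> Rd) :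
  measurable_fun [set: T] f -> measurable_fun [set: T] g ->
  measurable_fun [set: T] (fun x => f x + g x)%R.
Proof.
move=> mf mg; apply: measurable_fun_rV => i; under eq_fun do rewrite mxE.
by apply: measurable_funD; exact: measurable_rV_comp.
Qed.

Lemma measurable_rVZ dd (T : measurableType dd) (a : T -> R) (f : T -> Rd) :
  measurable_fun [set: T] a -> measurable_fun [set: T] f ->
  measurable_fun [set: T] (fun x => a x *: f x)%R.
Proof.
move=> ma mf; apply: measurable_fun_rV => i; under eq_fun do rewrite mxE.
by apply: measurable_funM => //; exact: measurable_rV_comp.
Qed.

Lemma measurable_rVN dd (T : measurableType dd) (f : T -> Rd) :
  measurable_fun [set: T] f -> measurable_fun [set: T] (fun x => - f x)%R.
Proof.
move=> mf; under eq_fun do rewrite -scaleN1r.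
by apply: measurable_rVZ.
Qed.

Lemma measurable_rVB dd (T : measurableType dd) (f g : T -> Rd) :
  measurable_fun [set: T] f -> measurable_fun [set: T] g ->
  measurable_fun [set: T] (fun x => f x - g x)%R.
Proof. by move=> mf mg; apply: measurable_rVD => //; exact: measurable_rVN. Qed.

Lemma measurable_dot dd (T : measurableType dd) (f g : T -> Rd) :
  measurable_fun [set: T] f -> measurable_fun [set: T] g ->
  measurable_fun [set: T] (fun x => dot (f x) (g x)).
Proof.
move=> mf mg; apply: measurable_sum => i.
by apply: measurable_funM; exact: measurable_rV_comp.
Qed.

Lemma measurable_enorm dd (T : measurableType dd) (f : T -> Rd) :
  measurable_fun [set: T] f -> measurable_fun [set: T] (fun x => enorm (f x)).
Proof.
move=> mf; under eq_fun do rewrite enormE.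
apply: measurableT_comp; last exact: measurable_dot.
by apply: continuous_measurable_fun => x; exact: sqrt_continuous.
Qed.

Lemma measurable_householder (w : Rd) : measurable_fun [set: Rd] (householder w).
Proof.
apply: measurable_rVB => //; apply: measurable_rVZ => //.
apply: measurable_funM => //; apply: measurable_funM => //.
exact: measurable_dot.
Qed.

End measurable_row_vectors.

Section translation_invariance.
Context {R : realType}.

Lemma lebesgue_measure_shift (a : R) (A : set R) : measurable A ->
  lebesgue_measure ((fun x => x + a)%R @^-1` A) = lebesgue_measure A.
Proof.
move=> mA; have msh : measurable_fun [set: R] (fun x : R => x + a)%R.
  exact: measurable_funD.
apply/esym.
apply: (@lebesgue_measure_unique R (pushforward (@lebesgue_measure R)
  (fun x : measurableTypeR R => x + a : measurableTypeR R)%R)) => //= _ [[s t]] _ <-.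
rewrite /pushforward (_ : _ @^-1` _ = `]s - a, t - a]%classic)%R; last first.
  by apply/seteqP; split => x /=; rewrite !in_itv/= ltrBlDr lerBrDr.
by rewrite !lebesgue_measure_itv/= !lte_fin ltrD2r -!EFinD opprD opprK addrACA addNr addr0.
Qed.

(** Both sides are measures in [A] that agree on rectangles, so the uniqueness
    of the product measure lifts the one-dimensional case. *)
Lemma lebesgue_rV_shift n (a : 'rV[R]_n) (A : set 'rV[R]_n) : measurable A ->
  lebesgue_rV n ((fun x => x + a)%R @^-1` A) = lebesgue_rV n A.
Proof.
elim: n a A => [|n IH] a A mA.
  rewrite (_ : _ @^-1` A = A)//; apply/seteqP.
  by split=> x /=; rewrite (_ : x + a = x)%R//; apply/rowP => -[].
rewrite /= /lebesgue_rV_step /pushforward.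
pose a1 := a ord0 ord0; pose a2 : 'rV[R]_n := \row_j a ord0 (lift ord0 j).
pose sh (p : measurableTypeR R * 'rV[R]_n) : measurableTypeR R * 'rV[R]_n :=
  (p.1 + a1, p.2 + a2)%R.
have msh : measurable_fun setT sh.
  apply: measurable_fun_pair; first exact: measurable_funD.
  exact: measurable_rVD.
have consD p : (rV_cons p + a)%R = rV_cons (sh p).
  apply/rowP => i; rewrite !mxE; case: unliftP => [j|] -> //=.
  by rewrite !mxE.
have -> : @rV_cons R n @^-1` ((fun x => x + a)%R @^-1` A) =
    sh @^-1` (@rV_cons R n @^-1` A).
  by apply/seteqP; split => p; rewrite /preimage/= consD.
have mB : measurable (@rV_cons R n @^-1` A).
  by rewrite -[X in measurable X]setTI; exact: measurable_rV_cons.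
pose nu := pushforward (@lebesgue_measure R \x lebesgue_rV n) sh.
apply/esym; apply: (@product_measure_unique _ _ _ _ _ (@lebesgue_measure R)
   (lebesgue_rV n) nu) => //= X Y mX mY.
rewrite -(lebesgue_measure_shift a1 mX) -(IH a2 Y mY) -product_measure1E//.
  by rewrite -[X in measurable X]setTI; exact: measurable_funD.
by rewrite -[X in measurable X]setTI; exact: measurable_rVD.
Qed.

Lemma integral_shift n (a : 'rV[R]_n) (phi : 'rV[R]_n -> \bar R) :
  measurable_fun setT phi -> (forall x, 0 <= phi x) ->
  \int[lebesgue_rV n]_x phi (x + a)%R = \int[lebesgue_rV n]_x phi x.
Proof.
move=> mphi phi0.
have msh : measurable_fun setT (fun x : 'rV[R]_n => x + a)%R.
  exact: measurable_rVD.
have := ge0_integral_pushforward msh (lebesgue_rV n) measurableT mphi.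
rewrite preimage_setT => <- //.
apply: eq_measure_integral => //= A mA _.
exact: lebesgue_rV_shift.
Qed.

End translation_invariance.

(** * Invariance of Lebesgue measure under involutive isometries *)

Section isometry_invariance.
Context {R : realType} {d : nat}.
Local Notation Rd := 'rV[R]_d.
Local Notation mu := (@lebesgue_rV R d).

Let ball : set Rd := [set x | (enorm x <= 1)%R].

Let measurable_ball : measurable ball.
Proof.
have me : measurable_fun setT (@enorm R d) by exact: measurable_enorm.
rewrite (_ : ball = setT `&` @enorm R d @^-1` `]-oo, 1%R]%classic); first exact: me.
by apply/seteqP; split => x /=; rewrite in_itv/= => -[].
Qed.

Lemma measurable_box (a b : Rd) :
  measurable [set x : Rd | forall i, x ord0 i \in `[a ord0 i, b ord0 i]%R].
Proof.
rewrite (_ : mkset _ = \bigcap_(i in [set: 'I_d])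
    ((fun x : Rd => x ord0 i) @^-1` `[a ord0 i, b ord0 i]%classic)).
  apply: fin_bigcap_measurable => // i _.
  by rewrite -[X in measurable X]setTI; exact: measurable_coord.
by apply/seteqP; split => x /= H i; have := H i => //; apply.
Qed.

(** The unit ball lies between two cubes; this positive and finite measure is
    what can be cancelled in [integral_isometry]. *)
Let ball_measure : exists2 c : R, (0 < c)%R & mu ball = c%:E.
Proof.
pose bx (r : R) : set Rd :=
  [set x | forall i, x ord0 i \in `[(const_mx (- r) : Rd) ord0 i, (const_mx r : Rd) ord0 i]%R].
have mbx r : measurable (bx r) by exact: measurable_box.
have bxE r : (0 <= r)%R -> mu (bx r) = ((r + r) ^+ d)%:E.
  move=> r0; rewrite lebesgue_rV_box; last by move=> i; rewrite !mxE; lra.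
  congr EFin; rewrite (eq_bigr (fun=> r + r)%R); last by move=> i _; rewrite !mxE opprK.
  by rewrite prodr_const card_ord.
(* [d * r ^+ 2 <= d * r <= 1], so the cube of half-side [r] is in the ball. *)
pose r := (d.+1%:R^-1 : R)%R.
have r0 : (0 < r)%R by rewrite invr_gt0.
have lo : bx r `<=` ball.
  move=> x xr; rewrite /ball/= -(@ler_pXn2r _ 2)// ?nnegrE ?enorm_ge0//.
  rewrite sqr_enorm expr1n (@le_trans _ _ (\sum_(i < d) r)%R)//.
    apply: ler_sum => i _; have := xr i; rewrite !mxE in_itv/=.
    have r1 : (r <= 1)%R by rewrite invf_le1// ler1n.
    by move=> /andP[? ?]; nra.
  rewrite sumr_const card_ord -mulr_natr mulrC ler_pdivrMr// mul1r ler_nat.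
  exact: leqnSn.
have hi : ball `<=` bx 1%R.
  move=> x; rewrite /ball/= => x1 i; rewrite !mxE in_itv/= -ler_norml.
  apply: le_trans x1; rewrite -(@ler_pXn2r _ 2)// ?nnegrE ?enorm_ge0//.
  rewrite sqr_enorm /dot (bigD1 i)//= real_normK ?num_real// -expr2 lerDl.
  by apply: sumr_ge0 => j _; rewrite -expr2 sqr_ge0.
have mulo : mu (bx r) <= mu ball by apply: le_measure; rewrite ?inE.
have muhi : mu ball <= mu (bx 1%R) by apply: le_measure; rewrite ?inE.
rewrite (bxE _ (ltW r0)) in mulo; rewrite bxE// in muhi.
have fin : mu ball \is a fin_num by rewrite ge0_fin_numE// (le_lt_trans muhi) ?ltry.
exists (fine (mu ball)); last by rewrite fineK.
by rewrite -lte_fin fineK// (lt_le_trans _ mulo)// lte_fin exprn_gt0// addr_gt0.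
Qed.

(** Let [b] be the indicator of the unit ball [B]. Substituting [w = v - T x]
    and using translation invariance in each variable, the double integral of
    [b (v - T x) * phi (T v)] equals both [mu B] times the integral of
    [phi \o T] (integrate in [x] first) and [mu B] times the integral of [phi]
    (integrate in [x] last), because [b] depends on the norm only. This is the
    uniqueness argument for Haar measure, where [B] fixes the constant. *)
Lemma integral_isometry (T : Rd -> Rd) (phi : Rd -> \bar R) :
  {morph T : x y / (x + y)%R} -> involutive T ->
  (forall x, enorm (T x) = enorm x) -> measurable_fun setT T ->
  measurable_fun setT phi -> (forall x, 0 <= phi x) ->
  \int[mu]_x phi (T x) = \int[mu]_x phi x.
Proof.
move=> TD TK Tn mT mphi phi0.
have TN x : T (- x)%R = (- T x)%R.
  have T0 : T 0%R = 0%R by apply: (addIr (T 0%R)); rewrite -TD !add0r.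
  by apply/eqP; rewrite -addr_eq0 -TD addNr T0.
have [c c0 muB] := ball_measure.
have c0' : 0 <= c%:E by rewrite lee_fin ltW.
pose b x : \bar R := (\1_ball x)%:E.
have b0 x : 0 <= b x by rewrite lee_fin.
have mb : measurable_fun setT b by apply/measurable_EFinP; exact: measurable_indic.
have bE x y : enorm x = enorm y -> b x = b y.
  move=> xy; rewrite /b !indicE (_ : (x \in ball) = (y \in ball))//.
  by apply/idP/idP; rewrite !inE /ball/= xy.
have intb : \int[mu]_x b x = c%:E by rewrite integral_indic// setIT.
have mpT : measurable_fun setT (fun x => phi (T x)) by exact: measurableT_comp mphi mT.
suff : c%:E * \int[mu]_x phi (T x) = c%:E * \int[mu]_x phi x.
  move=> /(congr1 (fun z => (c^-1)%:E * z)).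
  by rewrite !muleA -EFinM mulVf ?gt_eqF// !mul1e.
transitivity (\int[mu]_v \int[mu]_x (b (v - T x)%R * phi (T v))).
  rewrite -ge0_integralZl//.  apply: eq_integral => v _.
  rewrite ge0_integralZr//; last first.
    apply: measurableT_comp => //; apply: measurable_rVB => //.
  congr (_ * _); rewrite -intb.
  rewrite -(integral_shift (- T v)%R mb b0); apply: eq_integral => x _.
  by apply: bE; rewrite -[RHS]Tn TD TN TK enormB.
rewrite [LHS](fubini_tonelli (fun p : Rd * Rd => b (p.1 - T p.2)%R * phi (T p.1)))//; last 2 first.
  - apply: emeasurable_funM.
      apply: (measurableT_comp mb); apply: measurable_rVB => //.
      exact: (measurableT_comp mT).
    exact: (measurableT_comp mpT).
  - by move=> p; rewrite mule_ge0.
transitivity (\int[mu]_x \int[mu]_w (b w * phi (x + T w)%R)).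
  apply: eq_integral => x _ /=.
  rewrite -(integral_shift (T x)); last 2 first.
    - apply: emeasurable_funM => //; apply: measurableT_comp => //.
      exact: measurable_rVB.
    - by move=> w; rewrite mule_ge0.
  by apply: eq_integral => w _; rewrite addrK TD TK addrC.
rewrite [LHS](fubini_tonelli (fun p : Rd * Rd => b p.2 * phi (p.1 + T p.2)%R))//; last 2 first.
  - apply: emeasurable_funM; first exact: (measurableT_comp mb).
    apply: (measurableT_comp mphi); apply: measurable_rVD => //.
    exact: (measurableT_comp mT).
  - by move=> p; rewrite mule_ge0.
rewrite -intb -ge0_integralZr//; last exact: integral_ge0.
apply: eq_integral => w _ /=.
rewrite ge0_integralZl//; first by rewrite integral_shift.
by apply: measurableT_comp => //; exact: measurable_rVD.
Qed.

Lemma integral_reflect (z : Rd) (phi : Rd -> \bar R) :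
  measurable_fun setT phi -> (forall x, 0 <= phi x) ->
  \int[mu]_x phi (z - x)%R = \int[mu]_x phi x.
Proof.
move=> mphi phi0.
rewrite -(integral_shift z mphi phi0).
transitivity (\int[mu]_x phi (- x + z)%R).
  by apply: eq_integral => x _; rewrite addrC.
apply: (@integral_isometry -%R (fun x => phi (x + z)%R)) => //.
- exact: opprD.
- exact: opprK.
- exact: enormN.
- exact: measurable_rVN.
- by apply: measurableT_comp => //; exact: measurable_rVD.
Qed.

Lemma integral_householder (w : Rd) (phi : Rd -> \bar R) :
  measurable_fun setT phi -> (forall x, 0 <= phi x) ->
  \int[mu]_x phi (householder w x) = \int[mu]_x phi x.
Proof.
apply: integral_isometry; first exact: householderD.
- exact: householderK.
- exact: enorm_householder.
- exact: measurable_householder.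
Qed.

End isometry_invariance.

(** * Normalized convolutions *)

Section extended_division.
Context {R : realType}.
Implicit Types a b c : \bar R.

(** The case [b = +oo] is the convention [a / +oo = 0]. *)
Lemma ediv_le a b c : 0 < b -> 0 <= c -> a <= c * b -> a / b <= c.
Proof.
case: b => [b||]; rewrite ?lte_fin// => b0 c0 acb.
- by rewrite inver gt_eqF// lee_pdivrMr.
- by rewrite invey mule0.
Qed.

Lemma le_ediv a b (c : R) : (0 < c)%R -> a \is a fin_num -> a * c%:E <= b -> a <= b / c%:E.
Proof. by move=> c0 afin acb; rewrite inver gt_eqF// lee_pdivlMr. Qed.

Lemma measurable_inve_pos dd (T : measurableType dd) (u : T -> \bar R) :
  measurable_fun [set: T] u -> (forall x, 0 < u x) ->
  measurable_fun [set: T] (fun x => (u x)^-1).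
Proof.
move=> mU u0.
(* [fine +oo = 0] and [0 `^ (- 1) = 0] agree with [+oo^-1 = 0]. *)
rewrite (_ : (fun _ => _) = EFin \o (fun x => fine (u x) `^ (-1))%R).
  apply/measurable_EFinP; apply: (measurableT_comp (measurable_powR _)).
  exact: (measurableT_comp (fine_measurable measurableT)).
apply/funext => x /=; have := u0 x; case: (u x) => [r||]//= r0.
- by rewrite inver gt_eqF// powR_inv1// ltW.
- by rewrite invey powR0// oppr_eq0 oner_eq0.
Qed.

End extended_division.

Section normalized_convolution.
Context {R : realType} {d : nat}.
Local Notation Rd := 'rV[R]_d.
Local Notation mu := (@lebesgue_rV R d).
Context (f : Rd -> \bar R).
Hypothesis f_gt0 : forall x, 0 < f x.
Hypothesis mf : measurable_fun [set: Rd] f.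
Implicit Types (u v : Rd -> \bar R) (S : set Rd) (x y : Rd).

Let f_ge0 x : 0 <= f x. Proof. exact: ltW. Qed.

Definition nconv S u x : \bar R :=
  (\int[mu]_(y in S) (f (x - y)%R * f y * u y)) / f x.

Lemma iter_convSS (SS : Rd -> set Rd) n x :
  iter_conv f SS n.+2 x = nconv (SS x) (iter_conv f SS n.+1) x.
Proof. by []. Qed.

Lemma measurable_integrand u x : measurable_fun [set: Rd] u ->
  measurable_fun [set: Rd] (fun y => f (x - y)%R * f y * u y).
Proof.
move=> mU; apply: emeasurable_funM => //; apply: emeasurable_funM => //.
by apply: measurableT_comp => //; exact: measurable_rVB.
Qed.

Let integrand_ge0 u x y : 0 <= u y -> 0 <= f (x - y)%R * f y * u y.
Proof. by move=> u0; rewrite !mule_ge0. Qed.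

Lemma nconv_ge0 S u x : (forall y, S y -> 0 <= u y) -> 0 <= nconv S u x.
Proof.
move=> u0; rewrite /nconv mule_ge0 ?inve_ge0//.
by apply: integral_ge0 => y /u0; exact: integrand_ge0.
Qed.

Lemma nconv_mono S S' u v x : measurable S -> measurable S' ->
  measurable_fun setT u -> measurable_fun setT v ->
  (forall y, 0 <= u y) -> (forall y, 0 <= v y) ->
  S `<=` S' -> (forall y, S y -> u y <= v y) ->
  nconv S u x <= nconv S' v x.
Proof.
move=> mS mS' mU mv u0 v0 SS' uv; rewrite /nconv.
apply: lee_wpmul2r; first by rewrite inve_ge0.
have mI w : measurable_fun setT w -> forall T,
    measurable_fun T (fun y => f (x - y)%R * f y * w y).
  by move=> mw T; apply: measurable_funTS; exact: measurable_integrand.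
apply: le_trans.
  apply: (ge0_le_integral _ mS (f2 := fun y => f (x - y)%R * f y * v y)).
  - by move=> y _; exact: integrand_ge0.
  - exact: mI.
  - exact: mI.
  - by move=> y Sy; rewrite lee_wpmul2l ?uv// mule_ge0.
apply: ge0_subset_integral => //; first exact: mI.
by move=> y _; exact: integrand_ge0.
Qed.

Lemma nconv_setU S S1 S2 u x : measurable S -> measurable S1 -> measurable S2 ->
  measurable_fun setT u -> (forall y, 0 <= u y) -> S `<=` S1 `|` S2 ->
  nconv S u x <= nconv S1 u x + nconv S2 u x.
Proof.
move=> mS mS1 mS2 mU u0 SS.
have mD : measurable (S2 `\` S1) by exact: measurableD.
apply: (@le_trans _ _ (nconv (S1 `|` (S2 `\` S1)) u x)).
  apply: nconv_mono => //; first exact: measurableU.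
  by rewrite setUDr setDv setD0.
rewrite {1}/nconv ge0_integral_setU//; last 3 first.
- by apply: measurable_funTS; exact: measurable_integrand.
- by move=> y _; exact: integrand_ge0.
- by apply/disj_setPS => y [? []].
rewrite ge0_muleDl ?integral_ge0//; try by move=> y _; exact: integrand_ge0.
by apply: leeD => //; apply: nconv_mono => // y [].
Qed.

Lemma nconvZ S u x (k : \bar R) : measurable S -> measurable_fun setT u ->
  (forall y, 0 <= u y) -> 0 <= k ->
  nconv S (fun y => k * u y) x = k * nconv S u x.
Proof.
move=> mS mU u0 k0; rewrite /nconv muleA -ge0_integralZl//.
- by congr (_ / _); apply: eq_integral => y _; rewrite muleCA.
- by apply: measurable_funTS; exact: measurable_integrand.
- by move=> y _; exact: integrand_ge0.
Qed.

Lemma nconv_le_shifted S u x c : measurable S -> measurable_fun setT u ->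
  (forall y, 0 <= u y) -> 0 <= c ->
  (forall y, S y -> f (x - y)%R <= c * f x) ->
  nconv S u x <= c * \int[mu]_y (f y * u y).
Proof.
move=> mS mU u0 c0 Sc.
have mfu : measurable_fun setT (fun y => f y * u y) by exact: emeasurable_funM.
have fu0 y : 0 <= f y * u y by rewrite mule_ge0.
apply: ediv_le => //; first by rewrite mule_ge0// integral_ge0.
rewrite muleAC -ge0_integralZl//; last by rewrite mule_ge0.
apply: (@le_trans _ _ (\int[mu]_(y in S) (c * f x * (f y * u y)))).
  apply: ge0_le_integral => //.
  - by move=> y _; exact: integrand_ge0.
  - by apply: measurable_funTS; exact: measurable_integrand.
  - by apply: measurable_funTS; exact: emeasurable_funM.
  - by move=> y Sy; rewrite -muleA lee_wpmul2r// Sc.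
apply: ge0_subset_integral => //; first exact: emeasurable_funM.
by move=> y _; rewrite !mule_ge0.
Qed.

(** Here the remaining factor [f (x - y)] is integrated in [y], which is why
    reflection invariance of the measure is needed. *)
Lemma nconv_le_centered S u x c : measurable S -> measurable_fun setT u ->
  (forall y, 0 <= u y) -> 0 <= c ->
  (forall y, S y -> f y * u y <= c * f x) ->
  nconv S u x <= c * \int[mu]_y f y.
Proof.
move=> mS mU u0 c0 Sc.
apply: ediv_le => //; first by rewrite mule_ge0// integral_ge0.
rewrite muleAC -(integral_reflect x)// -ge0_integralZl//; last 2 first.
- by apply: measurableT_comp => //; exact: measurable_rVB.
- by rewrite mule_ge0.
have mfx : measurable_fun setT (fun y => c * f x * f (x - y)%R).
  apply: emeasurable_funM => //.
  by apply: measurableT_comp => //; exact: measurable_rVB.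
apply: (@le_trans _ _ (\int[mu]_(y in S) (c * f x * f (x - y)%R))).
  apply: ge0_le_integral => //.
  - by move=> y _; exact: integrand_ge0.
  - by apply: measurable_funTS; exact: measurable_integrand.
  - exact: measurable_funTS.
  - by move=> y Sy; rewrite -muleA muleC lee_wpmul2r// Sc.
by apply: ge0_subset_integral => // y _; rewrite !mule_ge0.
Qed.

Lemma iter_conv_ge0 (SS : Rd -> set Rd) n x : 0 <= iter_conv f SS n x.
Proof.
case: n => [|n]; first exact: lee01.
elim: n x => [|n IH] x; first exact: lee01.
by apply: nconv_ge0 => y _; exact: IH.
Qed.

Lemma measurable_iter_conv (SS : Rd -> set Rd) n :
  measurable [set p : Rd * Rd | SS p.1 p.2] ->
  measurable_fun setT (iter_conv f SS n).
Proof.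
move=> mSS; case: n => [|n]; first exact: measurable_cst.
elim: n => [|n IH]; first exact: measurable_cst.
rewrite /=; apply: emeasurable_funM; last exact: measurable_inve_pos.
pose k (p : Rd * Rd) := f (p.1 - p.2)%R * f p.2 * iter_conv f SS n.+1 p.2.
pose E := [set p : Rd * Rd | SS p.1 p.2].
have mk : measurable_fun setT (k \_ E).
  apply/(measurable_restrictT _ mSS); apply: measurable_funTS.
  apply: emeasurable_funM; last exact: (measurableT_comp IH).
  apply: emeasurable_funM; last exact: (measurableT_comp mf).
  by apply: (measurableT_comp mf); exact: measurable_rVB.
have k0 p : 0 <= (k \_ E) p.
  rewrite patchE; case: ifPn => // _; apply: integrand_ge0.
  exact: iter_conv_ge0.
have := @measurable_fun_fubini_tonelli_F _ _ _ _ _ mu _ mk k0.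
apply: eq_measurable_fun => x _; rewrite /fubini_F [RHS]integral_mkcond.
apply: eq_integral => y _; rewrite !patchE /k/=.
by congr (if _ then _ else _); apply/idP/idP; rewrite !inE.
Qed.

End normalized_convolution.

(** * The domains of integration *)

Section comparison_sets.
Context {R : realType} dd {T : measurableType dd}.
Implicit Types a b : T -> R.

Lemma measurable_set_ltr a b : measurable_fun setT a -> measurable_fun setT b ->
  measurable [set x | (a x < b x)%R].
Proof.
move=> ma mb; have mab := measurable_fun_ltr ma mb.
rewrite (_ : mkset _ = setT `&` (fun x => a x < b x)%R @^-1` [set true]).
  exact: mab.
by rewrite setTI; apply/seteqP; split => x /=.
Qed.

Lemma measurable_set_ler a b : measurable_fun setT a -> measurable_fun setT b ->
  measurable [set x | (a x <= b x)%R].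
Proof.
move=> ma mb; have mab := measurable_fun_ler ma mb.
rewrite (_ : mkset _ = setT `&` (fun x => a x <= b x)%R @^-1` [set true]).
  exact: mab.
by rewrite setTI; apply/seteqP; split => x /=.
Qed.

End comparison_sets.

Section domains.
Context {R : realType} {d : nat}.
Local Notation Rd := 'rV[R]_d.
Implicit Types (x y z : Rd).

Lemma measurable_domD_graph : measurable [set p : Rd * Rd | domD p.1 p.2].
Proof.
apply: measurableI; apply: measurable_set_ltr.
- exact: measurable_enorm.
- by apply: measurable_funB => //; exact: measurable_enorm.
- by apply: measurable_enorm; exact: measurable_rVB.
- by apply: measurable_funB => //; exact: measurable_enorm.
Qed.

Lemma measurable_domE_graph : measurable [set p : Rd * Rd | domE p.1 p.2].
Proof.
apply: measurableI; apply: measurable_set_ltr.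
- exact: measurable_enorm.
- exact: measurable_enorm.
- by apply: measurable_enorm; exact: measurable_rVB.
- exact: measurable_enorm.
Qed.

Lemma measurable_domD x : measurable (domD x).
Proof.
apply: measurableI; apply: measurable_set_ltr => //.
- exact: measurable_enorm.
- by apply: measurable_enorm; exact: measurable_rVB.
Qed.

Lemma measurable_domE x : measurable (domE x).
Proof.
apply: measurableI; apply: measurable_set_ltr => //.
- exact: measurable_enorm.
- by apply: measurable_enorm; exact: measurable_rVB.
Qed.

Lemma domD_sub_domE x : domD x `<=` domE x.
Proof. by move=> z []; rewrite /domE/=; split; lra. Qed.

Definition near_set (r : R) : set Rd := [set y | (enorm y <= r)%R].
Definition far_set (r : R) : set Rd := [set y | (r < enorm y)%R].
Definition cofar_set x (r : R) : set Rd := [set y | (r <= enorm (x - y)%R)%R].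

Lemma measurable_near_set r : measurable (near_set r).
Proof. by apply: measurable_set_ler => //; exact: measurable_enorm. Qed.

Lemma measurable_far_set r : measurable (far_set r).
Proof. by apply: measurable_set_ltr => //; exact: measurable_enorm. Qed.

Lemma measurable_cofar_set x r : measurable (cofar_set x r).
Proof.
apply: measurable_set_ler => //.
by apply: measurable_enorm; exact: measurable_rVB.
Qed.

Lemma near_at_infinity (r : R) : \forall x \near at_infinity R d, (r < enorm x)%R.
Proof. by exists r. Qed.

End domains.

(** * Growth of the iterates for a radial decreasing kernel *)

Section radial_kernel.
Context {R : realType} {d : nat}.
Local Notation Rd := 'rV[R]_d.
Local Notation mu := (@lebesgue_rV R d).
Context (f : Rd -> \bar R) (C1 C2 M : R).
Hypothesis f_gt0 : forall x, 0 < f x.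
Hypothesis mf : measurable_fun [set: Rd] f.
Hypothesis f_decr : forall x y, (enorm x <= enorm y)%R -> f y <= f x.
Hypothesis C1_ge1 : (1 <= C1)%R.
Hypothesis f_shift : forall x y, (1 <= enorm x)%R -> (enorm x <= enorm y)%R ->
    (enorm y <= enorm x + 1)%R -> f x <= C1%:E * f y.
Hypothesis C2_ge1 : (1 <= C2)%R.
Hypothesis f_double : forall x,
    (enorm x <= 1)%R -> f x <= C2%:E * f (2 *: x)%R.
Hypothesis intf : \int[mu]_x f x = M%:E.
Implicit Types (u v : Rd -> \bar R) (S : set Rd) (x y z : Rd).

Local Notation h := (hfun f).
Local Notation g := (gfun f).

Let f_ge0 x : 0 <= f x. Proof. exact: ltW. Qed.
Let M_ge0 : (0 <= M)%R. Proof. by rewrite -lee_fin -intf integral_ge0. Qed.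
Let C1_ge0 : (0 <= C1)%R. Proof. exact: le_trans C1_ge1. Qed.

Let h_ge0 n x : 0 <= h n x. Proof. exact: iter_conv_ge0. Qed.
Let g_ge0 n x : 0 <= g n x. Proof. exact: iter_conv_ge0. Qed.
Let mh n : measurable_fun setT (h n).
Proof. by apply: measurable_iter_conv => //; exact: measurable_domD_graph. Qed.
Let mg n : measurable_fun setT (g n).
Proof. by apply: measurable_iter_conv => //; exact: measurable_domE_graph. Qed.
Let mD := @measurable_domD R d.
Let mE := @measurable_domE R d.
Let mnear := @measurable_near_set R d.
Let mfar := @measurable_far_set R d.
Let mcofar := @measurable_cofar_set R d.

Let hSS n x : h n.+2 x = nconv f (domD x) (h n.+1) x. Proof. by []. Qed.
Let gSS n x : g n.+2 x = nconv f (domE x) (g n.+1) x. Proof. by []. Qed.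

Lemma radial_eq x y : enorm x = enorm y -> f x = f y.
Proof. by move=> xy; apply/eqP; rewrite eq_le !f_decr ?xy. Qed.

Lemma le_expC1 k x : f x <= (C1 ^+ k)%:E * f x.
Proof. by rewrite -{1}[f x]mul1e lee_wpmul2r// lee_fin exprn_ege1. Qed.

(** One unit step is taken along the ray of [x]: the intermediate point has norm
    [enorm x + 1] and only norms matter. *)
Lemma shift_iter k x y : (1 <= enorm x)%R ->
  (enorm y <= enorm x + k%:R)%R -> f x <= (C1 ^+ k)%:E * f y.
Proof.
elim: k x y => [|k IH] x y x1 yk.
  by rewrite expr0 mul1e f_decr//; lra.
have [yx|xy] := leP (enorm y) (enorm x).
  by apply: (le_trans (f_decr yx)); exact: le_expC1.
have [yx1|xy1] := leP (enorm y) (enorm x + 1)%R.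
  apply: (le_trans (f_shift x1 (ltW xy) yx1)).
  by rewrite exprSr EFinM -muleA muleCA lee_wpmul2l ?lee_fin//; exact: le_expC1.
pose z := ((enorm x + 1) / enorm x *: x)%R.
have zE : enorm z = (enorm x + 1)%R.
  rewrite enormZ ger0_norm ?divr_ge0; try lra.
  by rewrite divfK// gt_eqF//; lra.
apply: (@le_trans _ _ (C1%:E * f z)); first by apply: f_shift; lra.
rewrite exprS EFinM -muleA lee_wpmul2l ?lee_fin// IH ?zE; first by [].
  by lra.
by rewrite -natr1 in yk; lra.
Qed.

Lemma ex_nat_ge (r : R) : exists k : nat, (r <= k%:R)%R.
Proof.
exists (Num.bound `|r|); apply: (le_trans (ler_norm r)).
exact/ltW/archi_boundP.
Qed.

Lemma integral_fMr (B : \bar R) : 0 <= B -> \int[mu]_y (f y * B) = M%:E * B.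
Proof. by move=> B0; rewrite ge0_integralZr// intf. Qed.

(** For [|y| <= r] the point [x - y] has norm at least [|x| - r], so [f (x - y)]
    and [f x] are comparable, uniformly in [x]. *)
Lemma nconv_near r : exists2 K : R, (0 <= K)%R & forall x S u (B : R),
  measurable S -> measurable_fun setT u -> (forall y, 0 <= u y) ->
  S `<=` near_set r -> (r + 1 <= enorm x)%R -> (0 <= B)%R ->
  (forall y, S y -> u y <= B%:E) -> nconv f S u x <= (B * K)%:E.
Proof.
have [k rk] := ex_nat_ge r.
exists (C1 ^+ k * M)%R; first by rewrite mulr_ge0// exprn_ge0.
move=> x S u B mS mU u0 Sr rx B0 uB.
apply: (@le_trans _ _ (nconv f S (cst B%:E) x)).
  exact: nconv_mono.
have -> : (B * (C1 ^+ k * M))%:E = (C1 ^+ k)%:E * \int[mu]_y (f y * (cst B%:E y)).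
  by rewrite /= integral_fMr// -!EFinM; congr EFin; ring.
apply: nconv_le_shifted => //; first by rewrite lee_fin exprn_ge0.
move=> y /Sr; rewrite /near_set/= => yr.
have := enorm_subl_le x y => xy.
by apply: shift_iter; lra.
Qed.

Lemma nconv_near_far S u x r : measurable S -> measurable_fun setT u ->
  (forall y, 0 <= u y) ->
  nconv f S u x <= nconv f (S `&` near_set r) u x + nconv f (S `&` far_set r) u x.
Proof.
move=> mS mU u0; apply: nconv_setU => //; try exact: measurableI.
by move=> y yS; have [yr|yr] := leP (enorm y) r; [left|right]; split.
Qed.

Lemma hfun_le_gfun n x : h n x <= g n x.
Proof.
case: n => [|n]; first exact: lexx.
elim: n x => [|n IH] x; first exact: lexx.
rewrite (hSS n x) (gSS n x); apply: nconv_mono => //; exact: domD_sub_domE.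
Qed.

(** On [domE x] outside [domD x] one of [y], [x - y] has norm close to that of
    [x]: beyond [t = |x| - 1] if [|x| >= 2], where the shift condition applies.
    For [|x| < 2] it is enough that one of the norms is at least [t = |x| / 2],
    and the doubling condition compares [f] at [x / 2] and at [x]. *)
Lemma gfun2_le : exists2 K : R, (0 <= K)%R & forall x, g 2 x <= h 2 x + K%:E.
Proof.
have C2_ge0 : (0 <= C2)%R by exact: le_trans C2_ge1.
have C1_0 := C1_ge0.
have C12 : (0 <= C1 + C2)%R by exact: addr_ge0.
exists ((C1 + C2) * M + (C1 + C2) * M)%R => [|x].
  by rewrite addr_ge0// mulr_ge0.
have [t tf tE] : exists2 t : R,
    forall z, (t <= enorm z)%R -> (enorm z < enorm x)%R -> f z <= (C1 + C2)%:E * f x &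
    forall z, domE x z -> [\/ domD x z, (t <= enorm z)%R | (t <= enorm (x - z))%R].
  have [x2|x2] := leP 2%R (enorm x).
    exists (enorm x - 1)%R => [z xz zx|z _].
      apply: (@le_trans _ _ (C1%:E * f x)); first by apply: f_shift; lra.
      by rewrite lee_wpmul2r ?lee_fin//; lra.
    have [?|?] := leP (enorm x - 1)%R (enorm z); first exact: Or32.
    have [?|?] := leP (enorm x - 1)%R (enorm (x - z)); first exact: Or33.
    by apply: Or31; split.
  exists (enorm x / 2)%R => [z xz zx|z _].
    have x'E : enorm (2^-1 *: x)%R = (enorm x / 2)%R.
      by rewrite enormZ ger0_norm// mulrC.
    apply: (@le_trans _ _ (f (2^-1 *: x)%R)); first by rewrite f_decr// x'E.
    apply: (@le_trans _ _ (C2%:E * f x)).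
      have := @f_double (2^-1 *: x)%R.
      by rewrite scalerA mulfV// scale1r; apply; rewrite x'E; lra.
    by rewrite lee_wpmul2r ?lee_fin//; lra.
  have [?|?] := leP (enorm x / 2)%R (enorm z); first exact: Or32.
  apply: Or33; have := enorm_subl_le x z; lra.
pose Sf := domE x `&` [set y | (t <= enorm y)%R].
pose Sc := domE x `&` cofar_set x t.
have mSf : measurable Sf.
  by apply: measurableI => //; apply: measurable_set_ler => //; exact: measurable_enorm.
have mSc : measurable Sc by apply: measurableI.
have mSfc : measurable (Sf `|` Sc) by exact: measurableU.
rewrite gSS hSS.
apply: (@le_trans _ _ (nconv f (domD x) (cst 1) x + nconv f (Sf `|` Sc) (cst 1) x)).
  apply: nconv_setU => // z Ez.
  by have [?|?|?] := tE z Ez; [left|right; left|right; right].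
rewrite leeD2l// EFinD.
apply: (@le_trans _ _ (nconv f Sf (cst 1) x + nconv f Sc (cst 1) x)).
  exact: nconv_setU.
apply: leeD; rewrite EFinM.
  rewrite -intf; apply: nconv_le_centered => //.
  by move=> y [[yx _] ty]; rewrite /= mule1 tf.
rewrite -[M%:E]mule1 -integral_fMr//.
apply: nconv_le_shifted => //.
by move=> y [[_ yx] ty]; rewrite tf.
Qed.

(** [domE x] is contained in the ball of radius [|x|], so the bound propagates
    through the recursion as soon as [g 2] is bounded on balls; for [h 2] this
    holds because [|x - y| > 1] on [domD x]. *)
Lemma gfun_bounded n r :
  exists2 B : R, (0 <= B)%R & forall x, (enorm x <= r)%R -> g n.+1 x <= B%:E.
Proof.
have [k rk] := ex_nat_ge r.
have [K K0 gK] := gfun2_le.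
pose A := (C1 ^+ k * M + K)%R.
have A0 : (0 <= A)%R by rewrite addr_ge0// mulr_ge0// exprn_ge0.
have g2A x : (enorm x <= r)%R -> g 2 x <= A%:E.
  move=> xr; apply: (le_trans (gK x)); rewrite EFinD leeD2r// EFinM.
  rewrite -[M%:E]mule1 -integral_fMr// hSS.
  apply: nconv_le_shifted => //; first by rewrite lee_fin exprn_ge0.
  move=> y [yx yx']; apply: shift_iter; first by have := enorm_subl_le x y; lra.
  by have := enorm_ge0 (x - y)%R; lra.
elim: n => [|n [B B0 IH]]; first by exists 1%R.
exists (B * A)%R => [|x xr]; first exact: mulr_ge0.
apply: (@le_trans _ _ (nconv f (domE x) (fun=> B%:E * 1) x)).
  rewrite gSS; apply: (@le_trans _ _ (nconv f (domE x `&` near_set r) (g n.+1) x)).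
    apply: nconv_mono => //; first exact: measurableI.
    by move=> y [yx ?]; split => //; rewrite /near_set/=; lra.
  apply: nconv_mono => //; first exact: measurableI.
  - by move=> y; rewrite mule1.
  - by move=> y []; rewrite /near_set/= mule1 => _; exact: IH.
rewrite (@nconvZ _ _ _ _ _ _ (cst 1))// EFinM lee_wpmul2l//.
exact: g2A.
Qed.

Lemma hfun_fin n x : h n.+1 x \is a fin_num.
Proof.
have [B B0 gB] := gfun_bounded n (enorm x).
rewrite ge0_fin_numE// (le_lt_trans (hfun_le_gfun _ _))//.
by rewrite (le_lt_trans (gB x _)) ?ltry.
Qed.

(** [f * g n.+2] is dominated by the convolution of [f] with [f * g n.+1]. *)
Lemma integral_f_gfun n : \int[mu]_x (f x * g n.+1 x) <= (M ^+ n.+1)%:E.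
Proof.
elim: n => [|n IH]; first by rewrite expr1 -[M%:E]mule1 -integral_fMr.
have mfg : measurable_fun setT (fun y => f y * g n.+1 y) by exact: emeasurable_funM.
have fg0 y : 0 <= f y * g n.+1 y by rewrite mule_ge0.
have mfsub y : measurable_fun setT (fun x => f (x - y)%R).
  by apply: measurableT_comp => //; exact: measurable_rVB.
pose k (p : Rd * Rd) := f (p.1 - p.2)%R * (f p.2 * g n.+1 p.2).
have k0 p : 0 <= k p by rewrite !mule_ge0.
have mk : measurable_fun setT k.
  apply: emeasurable_funM; last exact: (measurableT_comp mfg).
  by apply: (measurableT_comp mf); exact: measurable_rVB.
apply: (@le_trans _ _ (\int[mu]_x \int[mu]_y k (x, y))).
  apply: ge0_le_integral => //.
  - by move=> x _; rewrite mule_ge0.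
  - exact: emeasurable_funM.
  - exact: (@measurable_fun_fubini_tonelli_F _ _ _ _ _ mu _ mk k0).
  - move=> x _; rewrite gSS /nconv; set a := (X in f x * (X / _)).
    have a0 : 0 <= a by apply: integral_ge0 => y _; rewrite !mule_ge0.
    apply: (@le_trans _ _ a).
      have := f_gt0 x; case: (f x) => [r||]//= r0; last by rewrite invey mule0 mule0.
      by rewrite inver gt_eqF// muleCA -EFinM mulfV ?gt_eqF// mule1.
    rewrite /a; under eq_integral do rewrite -muleA.
    apply: ge0_subset_integral => //; last by move=> y _; rewrite !mule_ge0.
    apply: emeasurable_funM => //; apply: measurableT_comp => //.
    exact: measurable_rVB.
rewrite fubini_tonelli//.
rewrite exprS EFinM; apply: (@le_trans _ _ (M%:E * \int[mu]_x (f x * g n.+1 x))); last first.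
  by rewrite lee_wpmul2l.
rewrite -ge0_integralZl//; apply: ge0_le_integral => //.
- by move=> x _; exact: integral_ge0.
- exact: (@measurable_fun_fubini_tonelli_G _ _ _ _ _ mu _ mk k0).
- exact: emeasurable_funM.
- move=> y _; rewrite /k/= ge0_integralZr//.
  by rewrite (integral_shift (- y)%R) ?intf.
Qed.

(** Substituting the reflected variable moves the domain [domD] and both factors
    of [f] along with [x], since they depend on norms of differences only. *)
Lemma hfun_householder w n x : h n (householder w x) = h n x.
Proof.
case: n => [//|n]; elim: n x => [//|n IH] x.
rewrite (hSS n (householder w x)) (hSS n x) /nconv.
rewrite (radial_eq (enorm_householder w x)); congr (_ / _).
have TB a b : (householder w a - householder w b)%R = householder w (a - b)%R.
  apply/eqP; rewrite subr_eq -householderD subrK; exact: eqxx.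
have mI S : measurable S -> measurable_fun setT
    ((fun y => f (householder w x - y)%R * f y * h n.+1 y) \_ S).
  move=> mS; apply/(measurable_restrictT _ mS).
  by apply: measurable_funTS; exact: (measurable_integrand mf (householder w x) (mh _)).
rewrite [LHS]integral_mkcond -(integral_householder w); last 2 first.
- exact: mI.
- by move=> y; rewrite patchE; case: ifP => // _; rewrite !mule_ge0.
rewrite [RHS]integral_mkcond; apply: eq_integral => y _; rewrite !patchE.
have -> : (householder w y \in domD (householder w x)) = (y \in domD x).
  by apply/idP/idP; rewrite !inE /domD/= TB !enorm_householder.
case: ifP => // _; rewrite IH TB.
by rewrite (radial_eq (enorm_householder w y)) (radial_eq (enorm_householder w _)).
Qed.

Lemma hfun_radial n x y : enorm x = enorm y -> h n x = h n y.
Proof. by move=> xy; rewrite -(householder_swap xy) hfun_householder. Qed.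

(** When [x' = l *: y] with [l >= 1] and [|x'| = |x|], [domD y] is contained in
    [domD x'] and the integrands compare pointwise, since [|y - z| > 1] on
    [domD y] lets the shift condition act on [f (y - z)]. The same step fails
    for [g], whose domain contains points [z] where [f (y - z)] is singular. *)
Lemma hfun_slow n x y : (enorm y <= enorm x)%R -> (enorm x <= enorm y + 1)%R ->
  h n.+1 y <= C1%:E * h n.+1 x.
Proof.
move=> yx xy; case: n => [|n]; first by rewrite mule1 lee_fin.
have [->|y0] := eqVneq y 0%R.
  rewrite hSS (_ : domD _ = set0); last first.
    by apply/seteqP; split => z //= -[]; rewrite enorm0 => H; have := enorm_ge0 z; lra.
  by rewrite /nconv integral_set0 mul0e mule_ge0.
have ny : (0 < enorm y)%R by rewrite lt_def enorm_eq0 y0 enorm_ge0.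
pose l := (enorm x / enorm y)%R; pose x' := (l *: y)%R.
have l1 : (1 <= l)%R by rewrite ler_pdivlMr// mul1r.
have x'E : enorm x' = enorm x by rewrite enormZ ger0_norm ?divfK ?gt_eqF//; lra.
rewrite -(hfun_radial _ x'E) !hSS.
have x'y : enorm (x' - y)%R = (enorm x' - enorm y)%R.
  rewrite (_ : x' - y = (l - 1) *: y)%R; last by rewrite scalerBl scale1r.
  by rewrite enormZ ger0_norm ?subr_ge0// mulrBl mul1r x'E /l divfK ?gt_eqF.
have tri z : (enorm (x' - z) <= enorm (y - z) + (enorm x' - enorm y))%R.
  by rewrite -x'y [leRHS]addrC (le_trans _ (enormD _ _))// addrA subrK.
rewrite /nconv muleA; apply: lee_pmul.
- by apply: integral_ge0 => z _; rewrite !mule_ge0.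
- by rewrite inve_ge0.
- rewrite -ge0_integralZl//; last 2 first.
  + by apply: measurable_funTS; exact: measurable_integrand.
  + by move=> z _; rewrite !mule_ge0.
  apply: (@le_trans _ _ (\int[mu]_(z in domD y) (C1%:E * (f (x' - z)%R * f z * h n.+1 z)))).
    apply: ge0_le_integral => //.
    * by move=> z _; rewrite !mule_ge0.
    * by apply: measurable_funTS; exact: measurable_integrand.
    * by apply: measurable_funTS; apply: emeasurable_funM => //; exact: measurable_integrand.
    * move=> z [zy yz]; rewrite !muleA; do 2 apply: lee_wpmul2r => //.
      rewrite -[C1]expr1; apply: shift_iter; first by have := enorm_subl_le y z; lra.
      by have := tri z; rewrite x'E mulr1n; lra.
  apply: ge0_subset_integral => //.
  + by apply: measurable_funTS; apply: emeasurable_funM => //; exact: measurable_integrand.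
  + by move=> z _; rewrite !mule_ge0.
  + by move=> z [zy yz]; split; [rewrite x'E; lra|have := tri z; rewrite x'E; lra].
- by rewrite lee_pV2 ?inE// f_decr ?x'E.
Qed.

Section divergence.
Hypothesis h2_div : forall A : R, \forall x \near at_infinity R d, A%:E <= h 2 x.

(** Far from the origin [h n.+2 >= 1], so [h n.+3] is at least the far part of
    the integral defining [h 2], and the near part of the latter is bounded. *)
Lemma hfun_diverges n (A : R) : \forall x \near at_infinity R d, A%:E <= h n.+2 x.
Proof.
elim: n A => [|n IH] A; first exact: h2_div.
have [r _ Hr] := IH 1%R.
have [K K0 nK] := nconv_near r.
apply: filterS2 (near_at_infinity (r + 1)%R) (h2_div (A + K)%R) => x xr hA.
have hle : h 2 x <= K%:E + h n.+3 x.
  apply: (@le_trans _ _ (nconv f (domD x `&` near_set r) (cst 1) x +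
      nconv f (domD x `&` far_set r) (cst 1) x)).
    by rewrite hSS; exact: nconv_near_far.
  apply: leeD.
    rewrite -[K]mul1r; apply: nK => //; first exact: measurableI.
    exact: ltW.
  rewrite hSS; apply: nconv_mono => //; first exact: measurableI.
  by move=> y [_]; exact: Hr.
have := le_trans hA hle; rewrite EFinD [X in X <= _]addeC leeD2lE//.
Qed.

(** The smallness of [h m / h n] passes under the integral for large [y]; the
    near part costs a constant, absorbed by the divergence of [h n.+1]. *)
Lemma hfun_littleo m n (e : R) : (m < n)%N -> (0 < e)%R ->
  \forall x \near at_infinity R d, h m.+1 x <= e%:E * h n.+1 x.
Proof.
elim: m n e => [|m IH] [//|n] e mn e0.
  apply: filterS (hfun_diverges n e^-1) => x hx.
  rewrite (@le_trans _ _ (e%:E * (e^-1)%:E))//; last by rewrite lee_wpmul2l// ltW.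
  by rewrite -EFinM mulfV ?gt_eqF.
have e20 : (0 < e / 2)%R by rewrite divr_gt0.
have [r _ Hr] := IH n (e / 2)%R mn e20.
have [B B0 gB] := gfun_bounded m r.
have [K K0 nK] := nconv_near r.
apply: filterS2 (near_at_infinity (r + 1)%R) (hfun_diverges n (B * K / (e / 2))%R) => x xr hA.
have hle : h m.+2 x <= (B * K)%:E + (e / 2)%:E * h n.+2 x.
  apply: (@le_trans _ _ (nconv f (domD x `&` near_set r) (h m.+1) x +
      nconv f (domD x `&` far_set r) (h m.+1) x)).
    by rewrite hSS; exact: nconv_near_far.
  apply: leeD.
    apply: nK => //; [exact: measurableI|exact: ltW|].
    by move=> y [_ yr]; apply: (le_trans (hfun_le_gfun _ _)); exact: gB.
  rewrite hSS -nconvZ//; last by rewrite lee_fin ltW.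
  apply: nconv_mono => //.
  - exact: measurableI.
  - exact: emeasurable_funM.
  - by move=> y; rewrite mule_ge0// lee_fin ltW.
  - by move=> y [_]; exact: Hr.
apply: (le_trans hle); move: hA.
rewrite -(fineK (hfun_fin n.+1 x)) -!EFinM -EFinD !lee_fin ler_pdivrMr//.
by move: (fine _) => t; lra.
Qed.

(** Four pieces of [domE x]: the ball of radius [r] (bounded), the collar near
    [|x - y| = |x|] (bounded since [f * g] is integrable), the collar near
    [|y| = |x|] (a multiple of [h n.+1 x], by [hfun_slow]), and the far part of
    [domD x], on which the induction hypothesis gives the main term. *)
Lemma gfun_equiv_hfun n (e : R) : (0 < e)%R ->
  \forall x \near at_infinity R d, g n.+1 x <= (1 + e)%:E * h n.+1 x.
Proof.
elim: n e => [|n IH] e e0.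
  by exists 0%R => // x _; rewrite mule1 lee_fin lerDl ltW.
have e20 : (0 < e / 2)%R by rewrite divr_gt0.
have [r _ Hr] := IH _ e20.
have [B B0 gB] := gfun_bounded n r.
have [K K0 nK] := nconv_near r.
pose P := (B * K + C1 * M ^+ n.+1)%R.
pose Q := ((1 + e / 2) * C1 * C1 * M)%R.
have Q0 : (0 <= Q)%R by rewrite !mulr_ge0//; lra.
have d0 : (0 < e / 4 / (Q + 1))%R by rewrite !divr_gt0//; lra.
have near1 := @near_at_infinity R d (Num.max (r + 1) 2)%R.
have near2 := hfun_diverges n (P / (e / 4))%R.
have near3 := hfun_littleo (ltnSn n) d0.
apply: filterS3 near1 near2 near3 => x; rewrite gt_max => /andP[xr x2] hP hQ.
have e1 : (0 <= 1 + e / 2)%R by lra.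
have mfarm1 : measurable (domE x `&` far_set r `&` [set y | (enorm x - 1 <= enorm y)%R]).
  apply: measurableI; first exact: measurableI.
  by apply: measurable_set_ler => //; exact: measurable_enorm.
set S4 := _ `&` _ `&` _ in mfarm1.
pose S1 := domE x `&` near_set r.
pose S2 := domD x `&` far_set r.
pose S3 := domE x `&` cofar_set x (enorm x - 1)%R.
have mS1 : measurable S1 by exact: measurableI.
have mS2 : measurable S2 by exact: measurableI.
have mS3 : measurable S3 by exact: measurableI.
have split4 : nconv f (domE x) (g n.+1) x <= nconv f S1 (g n.+1) x +
    (nconv f S3 (g n.+1) x + (nconv f S4 (g n.+1) x + nconv f S2 (g n.+1) x)).
  have m42 : measurable (S4 `|` S2) by exact: measurableU.
  have m342 : measurable (S3 `|` (S4 `|` S2)) by exact: measurableU.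
  apply: (@le_trans _ _ (nconv f S1 (g n.+1) x + nconv f (S3 `|` (S4 `|` S2)) (g n.+1) x)).
    apply: nconv_setU => // y Ey.
    have [yr|yr] := leP (enorm y) r; first by left.
    right; have [a|a] := leP (enorm x - 1)%R (enorm (x - y)%R); first by left.
    right; have [b|b] := leP (enorm x - 1)%R (enorm y); first by left.
    by right.
  apply: leeD2l; apply: (@le_trans _ _ (nconv f S3 (g n.+1) x + nconv f (S4 `|` S2) (g n.+1) x)).
    exact: nconv_setU.
  by apply: leeD2l; exact: nconv_setU.
have b1 : nconv f S1 (g n.+1) x <= (B * K)%:E.
  by apply: nK => // [y []//||y [_]]; [lra|exact: gB].
have b3 : nconv f S3 (g n.+1) x <= (C1 * M ^+ n.+1)%:E.
  apply: (@le_trans _ _ (C1%:E * \int[mu]_y (f y * g n.+1 y))).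
    apply: nconv_le_shifted => // y [[_ yx] xy]; move: xy; rewrite /cofar_set/= => xy.
    by apply: f_shift; lra.
  by rewrite EFinM lee_wpmul2l// integral_f_gfun.
have b4 : nconv f S4 (g n.+1) x <= Q%:E * h n.+1 x.
  rewrite (_ : Q%:E * _ = ((1 + e / 2) * C1 * C1)%:E * h n.+1 x * \int[mu]_y f y); last first.
    by rewrite intf /Q EFinM -!muleA; congr (_ * _); rewrite muleC.
  apply: nconv_le_centered => //.
    by rewrite mule_ge0// lee_fin !mulr_ge0.
  move=> y [[[yx _] yr] /= xy]; move: yr; rewrite /far_set/= => yr.
  apply: (@le_trans _ _ ((C1%:E * f x) * ((1 + e / 2)%:E * (C1%:E * h n.+1 x)))).
    apply: lee_pmul => //; first by apply: f_shift; lra.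
    apply: (le_trans (Hr y yr)); rewrite lee_wpmul2l ?lee_fin//.
    by apply: hfun_slow; lra.
  have mulCA (a b c k : \bar R) : a * b * (c * (a * k)) = c * a * a * k * b.
    by rewrite [LHS]muleC [c * (a * k)]muleA [LHS]muleACA muleA.
  by rewrite mulCA !EFinM.
have b2 : nconv f S2 (g n.+1) x <= (1 + e / 2)%:E * h n.+2 x.
  rewrite hSS -nconvZ//.
  apply: nconv_mono => //.
  - exact: emeasurable_funM.
  - by move=> y; rewrite mule_ge0// lee_fin.
  - by move=> y [].
  - by move=> y [_]; exact: Hr.
rewrite gSS; apply: (le_trans split4).
apply: (le_trans (leeD b1 (leeD b3 (leeD b4 b2)))).
move: hP hQ; rewrite -(fineK (hfun_fin n.+1 x)) -(fineK (hfun_fin n x)).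
rewrite -!EFinM -!EFinD !lee_fin.
have := fine_ge0 (h_ge0 n.+2 x).
move: (fine _) (fine _) => t s t0.
rewrite ler_pdivrMr; last by lra.
rewrite mulrAC ler_pdivlMr; last by lra.
rewrite /P => hP hQ.
have Q1 : (Q * s <= (Q + 1) * s \/ s < 0)%R.
  by have [?|?] := leP 0%R s; [left; nra|right].
nra.
Qed.

End divergence.

End radial_kernel.

(** * Limits at infinity and the theorem *)

Lemma cvge_from_above {R : realType} {T : Type} (F : set_system T) {FF : Filter F}
    (u : T -> \bar R) (l : R) :
  (forall e : R, (0 < e)%R ->
    \forall x \near F, l%:E <= u x /\ u x <= (l + e)%:E) ->
  u @ F --> l%:E.
Proof.
move=> ul; apply/fine_cvgP; split.
  apply: filterS (ul 1%R ltr01) => x [lu xl].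
  by rewrite fin_real// (lt_le_trans _ lu) ?ltNyr//= (le_lt_trans xl) ?ltry.
apply/cvgrPdist_le => e e0; apply: filterS (ul e e0) => x /=.
case: (u x) => [r||] []; rewrite ?lee_fin//= => lr rl.
by rewrite distrC ger0_norm ?subr_ge0// lerBlDl.
Qed.

Lemma iter_conv_geometric {R : realType} {d : nat} (f : 'rV[R]_d -> \bar R)
    (SS : 'rV[R]_d -> set 'rV[R]_d) (C : R) :
  (forall x, 0 < f x) -> measurable_fun [set: 'rV[R]_d] f ->
  measurable [set p : 'rV[R]_d * 'rV[R]_d | SS p.1 p.2] ->
  (forall x, measurable (SS x)) -> (0 < C)%R ->
  (forall x, iter_conv f SS 2 x <= C%:E) ->
  forall n, (2 <= n)%N -> forall x, iter_conv f SS n x <= (C ^+ (n - 1))%:E.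
Proof.
move=> f0 mf mG mS C0 C2 [//|[//|n]] _; rewrite subSS subn0.
elim: n => [|n IH] x; first exact: C2.
rewrite iter_convSS.
have Cn0 : (0 <= C ^+ n.+1)%R by rewrite exprn_ge0 ?ltW.
apply: (@le_trans _ _ (nconv f (SS x) (fun=> (C ^+ n.+1)%:E * 1) x)).
  apply: nconv_mono => //.
  - exact: measurable_iter_conv.
  - exact: iter_conv_ge0.
  - by move=> y; rewrite mule1 lee_fin.
  - by move=> y _; rewrite mule1.
rewrite (@nconvZ _ _ _ f0 mf _ (cst 1))// [(C ^+ n.+2)%R]exprSr EFinM lee_wpmul2l//.
exact: C2.
Qed.

Theorem lemma2p7 (R : realType) (d : nat) (hd : (1 <= d)%N)
    (f : 'rV[R]_d -> \bar R) (fA : assumptionA f) :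
  let g := gfun f in
  let h := hfun f in
  let diverges (u : 'rV[R]_d -> \bar R) := u @ at_infinity R d --> +oo in
  [/\ (* (a) *)
      (ereal_sup (range (g 2%N)) < +oo <-> ereal_sup (range (h 2%N)) < +oo) /\
      (diverges (g 2%N) <-> diverges (h 2%N)),
      (* (b) *)
      (forall C : R, (0 < C)%R -> (forall x, h 2%N x <= C%:E) ->
        forall n : nat, (2 <= n)%N -> forall x, h n x <= (C ^+ (n - 1))%:E) /\
      (forall C : R, (0 < C)%R -> (forall x, g 2%N x <= C%:E) ->
        forall n : nat, (2 <= n)%N -> forall x, g n x <= (C ^+ (n - 1))%:E),
      (* (c) *)
      (diverges (g 2%N) \/ diverges (h 2%N) ->
        forall n : nat, (2 <= n)%N -> diverges (g n) /\ diverges (h n)),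
      (* (d) *)
      (diverges (g 2%N) \/ diverges (h 2%N) ->
        forall m n : nat, (1 <= m)%N -> (m < n)%N ->
          (fun x => h m x / h n x) @ at_infinity R d --> 0) &
      (* (e) *)
      (diverges (g 2%N) \/ diverges (h 2%N) ->
        forall n : nat, (1 <= n)%N ->
          (fun x => g n x / h n x) @ at_infinity R d --> 1)].
Proof.
move=> g h diverges.
have f_gt0 := A_pos fA.
have [_ f_int _] := A_density fA.
have mf : measurable_fun setT f by exact: measurable_int f_int.
have f_ge0 x : 0 <= f x by exact: ltW.
have [F F_decr fE] := A_radial fA.
have f_decr x y : (enorm x <= enorm y)%R -> f y <= f x.
  by move=> xy; rewrite !fE F_decr// enorm_ge0.
have [C1 C1_ge1 f_shift] := A_shift fA.
have [C2 C2_ge1 f_double] := A_double fA.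
have [M intf] : exists M : R, \int[@lebesgue_rV R d]_x f x = M%:E.
  exists (fine (\int[@lebesgue_rV R d]_x f x)); rewrite fineK// ge0_fin_numE.
    have /integrableP[_] := f_int; apply: le_lt_trans.
    by rewrite le_eqVlt; apply/orP; left; apply/eqP/eq_integral => x _; rewrite gee0_abs.
  exact: integral_ge0.
have hg := hfun_le_gfun f_gt0 mf.
have [K K0 gK] := gfun2_le f_gt0 mf f_decr C1_ge1 f_shift C2_ge1 f_double intf.
have hfin := hfun_fin f_gt0 mf f_decr C1_ge1 f_shift C2_ge1 f_double intf.
have g_div_h : diverges (g 2%N) -> diverges (h 2%N).
  move=> /cvgeyPge gd; apply/cvgeyPge => A.
  apply: filterS (gd (A + K)%R) => x gx.
  by have := le_trans gx (gK x); rewrite EFinD leeD2rE.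
have h_div_g n : diverges (h n) -> diverges (g n).
  move=> /cvgeyPge hdv; apply/cvgeyPge => A.
  by apply: filterS (hdv A) => x hx; exact: le_trans hx (hg n x).
have h2_div : diverges (g 2%N) \/ diverges (h 2%N) ->
    forall A : R, \forall x \near at_infinity R d, A%:E <= h 2%N x.
  by move=> [/g_div_h|] /cvgeyPge.
have h_pos : diverges (g 2%N) \/ diverges (h 2%N) ->
    forall n, \forall x \near at_infinity R d, 0 < h n.+1 x.
  move=> /h2_div dv [|n]; first by exists 0%R => // x _; exact: lte01.
  have := hfun_diverges f_gt0 mf f_decr C1_ge1 f_shift intf dv n 1%R.
  by apply: filterS => x; exact: lt_le_trans.
split.
- split; last by split; [exact: g_div_h|exact: h_div_g].
  split => sup_fin.
    apply: le_lt_trans sup_fin; apply: ge_ereal_sup => _ [x _ <-].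
    by apply: (le_trans (hg 2%N x)); apply: ereal_sup_ubound; exists x.
  apply: (@le_lt_trans _ _ (ereal_sup (range (h 2%N)) + K%:E)).
    apply: ge_ereal_sup => _ [x _ <-]; apply: (le_trans (gK x)).
    by rewrite leeD2r//; apply: ereal_sup_ubound; exists x.
  by rewrite lte_add_pinfty ?ltry.
- split=> C C0 hC; apply: iter_conv_geometric => //.
  + exact: measurable_domD_graph.
  + exact: measurable_domD.
  + exact: measurable_domE_graph.
  + exact: measurable_domE.
- move=> /h2_div dv [//|[//|n]] _.
  have hn : diverges (h n.+2).
    apply/cvgeyPge.
    exact: (hfun_diverges f_gt0 mf f_decr C1_ge1 f_shift intf dv).
  by split; [exact: h_div_g|exact: hn].
- move=> dv [//|m] [//|n] _; rewrite ltnS => mn.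
  apply: (@cvge_from_above _ _ _ _ _ 0%R) => e e0.
  have lo := hfun_littleo f_gt0 mf f_decr C1_ge1 f_shift C2_ge1 f_double intf
    (h2_div dv) mn e0.
  apply: filterS2 lo (h_pos dv n) => x hmn hn0; split.
    by rewrite mule_ge0 ?inve_ge0// iter_conv_ge0.
  by rewrite add0r ediv_le// lee_fin ltW.
- move=> dv [//|n] _.
  apply: (@cvge_from_above _ _ _ _ _ 1%R) => e e0.
  have eq := gfun_equiv_hfun f_gt0 mf f_decr C1_ge1 f_shift C2_ge1 f_double intf
    (h2_div dv) n e0.
  apply: filterS2 eq (h_pos dv n) => x gh hn0; split; last first.
    by rewrite ediv_le// lee_fin; lra.
  have hEx : h n.+1 x = (fine (h n.+1 x))%:E by rewrite fineK//; exact: hfin.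
  rewrite hEx le_ediv// ?mul1e; first by rewrite -lte_fin -hEx.
  by rewrite -hEx; exact: hg.
Qed.
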